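(* Let $G=(V,E)$ be a graph with $n=|V|$ vertices and edge weights $c:E\to\mathbb{R}_+$, and let $k\le n$ be a positive integer. Let $T=(V',E')$ be a tree with edge weights $c_T:E'\to\mathbb{R}_+$ whose leaf set is $V$ (so $V'\supseteq V$) such that for every $U\subset V$, $$c(\delta_G(U))\le \operatorname{mincut}_T(U,V\setminus U)\le O(\log^{1.5}n\,\log\log n)\, c(\delta_G(U)).$$ Give each leaf of $T$ weight $w=1$ and each internal node of $T$ weight $w=0$, and give each vertex of $G$ weight $1$. Let $\mathcal{S}=\{S_1,\dots,S_k\}$ be a subpartition of $V$ minimizing the mean isoperimetry cost in $G$. Then there exists a subpartition $\mathcal{S}'=\{S'_1,\dots,S'_k\}$ of $V'$ such that $$\mathrm{cost}_T(\mathcal{S}')\le O(\log^{1.5}n\,\log\log n)\,\mathrm{cost}_G(\mathcal{S}).$$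
   Context: A subpartition of a set $S$ into $k$ parts is a collection of $k$ nonempty pairwise disjoint subsets of $S$, not necessarily covering $S$. For a graph $H$ with edge weights $c_H$ and vertex weights $w$, and $U\subseteq V(H)$, $\delta_H(U)$ is the set of edges with exactly one endpoint in $U$, $c_H(\delta_H(U))$ its total weight, and $w(U)=\sum_{u\in U}w(u)$. The mean isoperimetry cost of a subpartition $\{A_1,\dots,A_k\}$ in $H$ is $\mathrm{cost}_H=\sum_{i=1}^k c_H(\delta_H(A_i))/w(A_i)$. For $U_1,U_2\subseteq V'$, $\operatorname{mincut}_T(U_1,U_2)$ is the minimum total $c_T$-weight of a set of edges of $T$ whose removal disconnects $U_1$ from $U_2$. *)

(* Defs.v *)
From HB Require Import structures.
From mathcomp Require Import all_boot all_order all_algebra.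
From mathcomp Require Import all_classical all_reals all_analysis.

Set Implicit Arguments.
Unset Strict Implicit.
Unset Printing Implicit Defensive.

Import Order.TTheory GRing.Theory Num.Theory.
Import numFieldNormedType.Exports.

Local Open Scope ring_scope.

(* A finite simple graph on the vertex set V with nonnegative edge weights.
   Edges are 2-element vertex sets; only the values of weight on edges
   matter. *)
Record wgraph (R : realType) (V : finType) := WGraph {
  edges : {set {set V}};
  weight : {set V} -> R;
  edges_card2 : forall e, e \in edges -> #|e| = 2;
  weight_ge0 : forall e, e \in edges -> 0 <= weight e }.

Section Graphs.
Variables (R : realType) (V : finType).
Implicit Types (H : wgraph R V) (F : {set {set V}}) (U : {set V}).

Definition total_weight H F : R := \sum_(e in F) weight H e.

Definition delta H U : {set {set V}} := [set e in edges H | #|e :&: U| == 1].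

Definition adj F : rel V := fun x y => [set x; y] \in F.

Definition is_tree H : Prop :=
  [/\ (0 < #|V|)%N,
      forall x y, connect (adj (edges H)) x y
    & forall p : seq V,
        cycle (adj (edges H)) p -> uniq p -> (size p <= 2)%N].

Definition degree H (x : V) : nat := #|[set e in edges H | x \in e]|.

(* In a tree with at least two vertices these are the vertices of degree 1;
   the only vertex of a one-vertex tree counts as a leaf. *)
Definition leaves H : {set V} := [set x | (degree H x <= 1)%N].

Definition disconnects H F (U1 U2 : {set V}) : bool :=
  [forall x in U1, forall y in U2, ~~ connect (adj (edges H :\: F)) x y].

(* When U1 and U2 are disjoint, F = edges H disconnects them and has the
   largest weight among all candidates, so the default value of the iterated
   minimum does not affect it. *)
Definition mincut H (U1 U2 : {set V}) : R :=
  \big[Num.min/total_weight H (edges H)]_(F in powerset (edges H)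
     | disconnects H F U1 U2) total_weight H F.

Definition vweight (w : V -> R) U : R := \sum_(u in U) w u.

Definition subpartition (k : nat) (P : {set {set V}}) : Prop :=
  [/\ #|P| = k, finset.set0 \notin P & finset.trivIset P].

(* Since x / 0 = 0 here, this is meaningful only if every part of P has
   positive vertex weight. *)
Definition cost H (w : V -> R) (P : {set {set V}}) : R :=
  \sum_(A in P) total_weight H (delta H A) / vweight w A.

Definition leaf_weight H : V -> R := fun x => (x \in leaves H)%:R.

End Graphs.

Definition polylog (R : realType) (n : nat) : R :=
  powR (ln n%:R) (3%:R / 2%:R) * ln (ln n%:R).

Local Open Scope classical_set_scope.

(* f(n) = O(log^1.5 n log log n) as n tends to infinity; the filter \oo
   makes this insensitive to n <= 2, where log log n is negative or
   undefined. *)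
Definition is_O_polylog (R : realType) (f : nat -> R) : Prop :=
  (f : nat -> R^o) =O_\oo (@polylog R : nat -> R^o).

(* Main.v *)
(* For each part [A] of [S] pick a set of tree vertices that meets the leaf set
   exactly in [A], has the smallest possible boundary weight and, among those,
   the fewest vertices.  Its boundary weighs at most the minimum cut between
   [A] and the other leaves.  If the sets [B1] and [B2] chosen for two parts
   met, posimodularity would make [B1 :\: B2] another minimizer for the first
   part, with fewer vertices; hence the chosen sets are disjoint, and their costs
   compare term by term with those of [S]. *)

Require Import Defs.
From HB Require Import structures.
From mathcomp Require Import all_boot all_order all_algebra.
From mathcomp Require Import all_classical all_reals all_analysis.
From mathcomp Require Import lra.

Set Implicit Arguments.
Unset Strict Implicit.
Unset Printing Implicit Defensive.

Import Order.TTheory GRing.Theory Num.Theory.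
Import numFieldNormedType.Exports.

Local Open Scope ring_scope.

Section CutSides.
Variables (R : realType) (V : finType) (H : wgraph R V).
Implicit Types (A B X : {set V}) (F : {set {set V}}).

Let cut A := total_weight H (delta H A).

Lemma card_set2I_eq1 (x y : V) A :
  x != y -> (#|[set x; y] :&: A| == 1) = (x \in A) (+) (y \in A).
Proof.
move=> xy; have -> : #|[set x; y] :&: A| = ((x \in A) + (y \in A))%N.
  rewrite (cardsD1 x) (cardsD1 y) !inE !eqxx (eq_sym y x) (negPf xy) ?orbT /=.
  rewrite (_ : _ :\ y = finset.set0) ?cards0 ?addn0 //.
  by apply/setP => z; rewrite !inE; case: (z == x); case: (z == y).
by case: (x \in A); case: (y \in A).
Qed.

Lemma total_weight_cut A :
  cut A = \sum_(e in edges H) weight H e *+ (#|e :&: A| == 1).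
Proof.
rewrite /cut /total_weight big_mkcond [RHS]big_mkcond; apply: eq_bigr => e _.
by rewrite inE; case: (e \in edges H) => //=; case: ifP.
Qed.

(** The inequality holds edge by edge: an edge's contribution depends only on which of the two sets
    contain its endpoints, so sixteen Boolean cases settle it. *)
Lemma cut_posimodular A B : cut (A :\: B) + cut (B :\: A) <= cut A + cut B.
Proof.
rewrite !total_weight_cut -!big_split; apply: ler_sum => e eH /=.
have := weight_ge0 eH.
have /eqP/cards2P[x [y [xy ->]]] := edges_card2 eH.
rewrite -!mulrnDr => w0; apply: ler_wpMn2l => //.
rewrite !card_set2I_eq1 // !inE.
by do 4![case: (_ \in _)].
Qed.

Lemma le_total_weight F1 F2 :
  F1 \subset F2 -> F2 \subset edges H -> total_weight H F1 <= total_weight H F2.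
Proof.
move=> F12 F2H; rewrite /total_weight [leRHS](big_setID F1) /=.
rewrite (finset.setIidPr F12) lerDl; apply: sumr_ge0 => e.
by rewrite inE => /andP[_ eF2]; apply/weight_ge0/(fintype.subsetP F2H).
Qed.

Lemma disconnects_side F A B :
  F \subset edges H -> disconnects H F A B ->
  exists X, [/\ A \subset X, [disjoint X & B] & delta H X \subset F].
Proof.
move=> FH dis; pose e := adj (edges H :\: F).
(* The side is everything reachable from [A] once [F] is removed. An edge outside [F] cannot leave
   it, since it would extend reachability. *)
exists [set y | [exists x in A, connect e x y]]; split.
- apply/fintype.subsetP => x xA; rewrite inE; apply/existsP; exists x.
  by rewrite xA connect0.
- apply/pred0P => y /=; rewrite inE; apply/negP.
  move=> /andP[/existsP[x /andP[xA xy]] yB].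
  by move/forall_inP: dis => /(_ x xA)/forall_inP/(_ y yB); rewrite xy.
- apply/fintype.subsetP => f; rewrite inE => /andP[fH]; apply: contraLR => fF.
  have /eqP/cards2P[x [y [xy Ef]]] := edges_card2 fH.
  have exy : e x y by rewrite /e /adj -Ef inE fF.
  have eyx : e y x by rewrite /e /adj finset.setUC -Ef inE fF.
  rewrite Ef card_set2I_eq1 // !inE -negb_eqb negbK; apply/eqP.
  apply/exists_inP/exists_inP => -[z zA zc]; exists z => //.
    exact: connect_trans zc (connect1 exy).
  exact: connect_trans zc (connect1 eyx).
Qed.

(** Given the second clause, [cut C <= cut B] says that [C] is also a minimizer, so the third clause
    breaks ties by cardinality. *)
Definition tight_side X A B :=
  [/\ B :&: X = A, forall C, C :&: X = A -> cut B <= cut C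
    & forall C, C :&: X = A -> cut C <= cut B -> (#|B| <= #|C|)%N].

Lemma tight_side_exists X A : A \subset X -> exists B, tight_side X A B.
Proof.
move=> AX; have AXE : A :&: X == A by apply/eqP/finset.setIidPl.
case: (@arg_minP _ _ _ A (fun B => B :&: X == A) cut AXE) => B0 /eqP B0X B0min.
have P0 : (B0 :&: X == A) && (cut B0 <= cut B0) by rewrite B0X eqxx lexx.
case: (@arg_minnP _ B0 (fun B => (B :&: X == A) && (cut B <= cut B0))
         (fun B => #|B|) P0) => B /andP[/eqP BX BB0] Bmin.
exists B; split=> // C CX.
  by rewrite (le_trans BB0) // B0min ?CX.
by move=> CB; apply: Bmin; rewrite CX eqxx (le_trans CB).
Qed.

Lemma tight_side_disjoint X A1 A2 B1 B2 :
  tight_side X A1 B1 -> tight_side X A2 B2 -> [disjoint A1 & A2] ->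
  [disjoint B1 & B2].
Proof.
move=> [B1X min1 card1] [B2X min2 _] dis.
(* Subtracting a set whose trace on [X] is disjoint keeps the trace, so both differences compete
   with the original sides. *)
have DX (C1 C2 D1 D2 : {set V}) : C1 :&: X = D1 -> C2 :&: X = D2 ->
    [disjoint D1 & D2] -> (C1 :\: C2) :&: X = D1.
  move=> <- <- /pred0P d; apply/setP => x; have := d x; rewrite /= !inE.
  by do 3![case: (_ \in _)].
have D1 := DX _ _ _ _ B1X B2X dis.
have D2 : (B2 :\: B1) :&: X = A2 by apply: DX B2X B1X _; rewrite disjoint_sym.
have le1 : cut (B1 :\: B2) <= cut B1.
  by have := cut_posimodular B1 B2; have := min2 _ D2; lra.
(* Now [B1] has at most as many elements as [B1 :\: B2], which forces [B1 :&: B2] to be empty. *)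
have := card1 _ D1 le1.
rewrite -(cardsID B2 B1) -[leqRHS]add0n leq_add2r leqn0 cards_eq0.
by rewrite finset.setI_eq0.
Qed.

(** Each disconnecting edge set contains the boundary of some [Y] whose trace on [X] is exactly [A],
    and [B] cuts no more than [Y]. *)
Lemma tight_side_le_mincut X A B :
  A \subset X -> tight_side X A B -> cut B <= mincut H A (X :\: A).
Proof.
move=> AX [BX Bmin _]; apply/bigmin_geP; split.
  (* The default value of the iterated minimum, the weight of all edges, also bounds the cut. *)
  apply: le_total_weight => //; apply/fintype.subsetP => e.
  by rewrite inE => /andP[].
move=> F /andP[]; rewrite inE => FH /(disconnects_side FH)[Y [AY YA YF]].
apply: (le_trans (Bmin Y _)); last exact: le_total_weight.
apply/setP => x; rewrite inE; have /pred0P/(_ x) := YA; rewrite /= inE.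
have := fintype.subsetP AX x; have := fintype.subsetP AY x.
by case: (x \in A) => [-> // -> //|_ _]; case: (x \in Y); case: (x \in X).
Qed.

End CutSides.

Theorem theorem2 (R : realType) (alpha : nat -> R)
    (alphaO : is_O_polylog alpha) :
  exists beta : nat -> R, is_O_polylog beta /\
  forall (V : finType) (G : wgraph R V) (k : nat)
         (V' : finType) (T : wgraph R V') (iota : V -> V'),
    (0 < k)%N -> (k <= #|V|)%N ->
    is_tree T ->
    injective iota ->
    leaves T = [set iota x | x in [set: V]] ->
    (forall U : {set V},
       total_weight G (delta G U)
         <= mincut T [set iota x | x in U] [set iota x | x in ~: U] /\
       mincut T [set iota x | x in U] [set iota x | x in ~: U]
         <= alpha #|V| * total_weight G (delta G U)) ->
    forall S : {set {set V}},
      subpartition k S ->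
      (forall P : {set {set V}}, subpartition k P ->
         cost G (fun=> 1) S <= cost G (fun=> 1) P) ->
      exists S' : {set {set V'}},
        [/\ subpartition k S',
            forall A, A \in S' -> 0 < vweight (leaf_weight T) A
          & cost T (leaf_weight T) S'
              <= beta #|V| * cost G (fun=> 1) S].
Proof.
(* Nothing is lost beyond the sparsifier's own factor, so [beta] is [alpha]. *)
exists alpha; split=> // V G k V' T iota _ _ _ iotaI leavesT sparse S.
move=> [cardS S0 trivS] _; pose X := [set iota x | x in [set: V]].
have subX (A : {set V}) : [set iota x | x in A] \subset X.
  exact/imsetS/finset.subsetT.
have [f fP] := choice (fun A : {set V} => tight_side_exists T (subX A)).
(* Internal nodes weigh 0 and [f A] contains exactly the leaves coming from [A], so the denominators
   of the two costs agree. *)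
have wf A : vweight (leaf_weight T) (f A) = #|A|%:R.
  have [fX _ _] := fP A; rewrite -(card_imset _ iotaI) -fX -sum1_card natr_sum.
  rewrite /vweight big_mkcond [RHS]big_mkcond; apply: eq_bigr => x _.
  by rewrite /leaf_weight leavesT inE; do 2![case: (_ \in _)].
have f_inj : injective f.
  move=> A B fAB; apply: (imset_inj iotaI).
  by have [<- _ _] := fP A; have [<- _ _] := fP B; rewrite fAB.
have S_gt0 A : A \in S -> (0 < #|A|)%N.
  by move=> AS; rewrite card_gt0; apply: contraNneq S0 => <-.
have pos A : A \in [set f B | B in S] -> 0 < vweight (leaf_weight T) A.
  by case/imsetP => B BS ->; rewrite wf ltr0n S_gt0.
exists [set f A | A in S]; split=> //.
- split; first by rewrite card_imset.
  + by apply/negP => /pos; rewrite /vweight big_set0 ltxx.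
  + apply/finset.trivIsetP => _ _ /imsetP[A AS ->] /imsetP[B BS ->] fAB.
    apply: tight_side_disjoint (fP A) (fP B) _.
    have AB : A != B by apply: contraNneq fAB => ->.
    have /finset.trivIsetP/(_ A B AS BS AB) := trivS.
    by rewrite imset_disjoint.
- rewrite /cost big_imset /=; last by move=> A B _ _; apply: f_inj.
  rewrite mulr_sumr; apply: ler_sum => A AS; rewrite wf mulrA.
  rewrite /vweight sumr_const; apply: ler_wpM2r; first by rewrite invr_ge0.
  (* The minimum cut lies between the cut of [f A] and [alpha] times the cut of [A]; it remains to
     identify the image of [~: A] with the leaves outside the image of [A]. *)
  have [_] := sparse A; apply: le_trans.
  suff -> : [set iota x | x in ~: A] = X :\: [set iota x | x in A].
    exact: tight_side_le_mincut (subX A) (fP A).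
  apply/setP => y; rewrite !inE; apply/imsetP/andP.
  + case=> x xA ->; rewrite mem_imset // imset_f //; split=> //.
    by rewrite inE in xA.
  + case=> yA /imsetP[x _ yx]; exists x => //; rewrite inE.
    by move: yA; rewrite yx mem_imset.
Qed.
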